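(* $n(5,9) \leq 1116$; that is, there exists a $5$-regular graph of girth exactly $9$ with at most $1116$ vertices.
   Context: Graphs are finite and simple. For integers $k\ge 2$, $g\ge 3$, a $(k,g)$-graph is a $k$-regular graph with girth $g$ (the length of a shortest cycle is exactly $g$). $n(k,g)$ denotes the smallest possible number of vertices of a $(k,g)$-graph. *)

(* Defs.v *)
From mathcomp Require Import all_boot.
Set Implicit Arguments.
Unset Strict Implicit.
Unset Printing Implicit Defensive.

Record sgraph := SGraph {
  vertex :> finType;
  adj : rel vertex;
  adj_sym : symmetric adj;
  adj_irr : irreflexive adj
}.

Definition regular (G : sgraph) (k : nat) : Prop :=
  forall x : G, #|[set y | adj x y]| = k.

(* [ucycle] is a closed walk without repeated vertices; it also accepts the
   degenerate sequences [::] and [:: x; y] (an edge walked back and forth),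
   which the bound on the size excludes. *)
Definition graph_cycle (G : sgraph) (c : seq G) : Prop :=
  ucycle (@adj G) c /\ 3 <= size c.

Definition girth_is (G : sgraph) (g : nat) : Prop :=
  (exists c : seq G, graph_cycle c /\ size c = g) /\
  (forall c : seq G, graph_cycle c -> g <= size c).

Definition kg_graph (k g : nat) (G : sgraph) : Prop :=
  regular G k /\ girth_is G g.

(* [is_min_order k g n] expresses n = n(k,g). A relation is used so that no
   default value is needed when no (k,g)-graph exists. *)
Definition is_min_order (k g n : nat) : Prop :=
  (exists G : sgraph, kg_graph k g G /\ #|G| = n) /\
  (forall G : sgraph, kg_graph k g G -> n <= #|G|).

(* Main.v *)
Require Import Defs.
From mathcomp Require Import all_boot.
From mathcomp Require Import all_algebra zify.
From Stdlib Require Import Classical.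

Set Implicit Arguments.
Unset Strict Implicit.
Unset Printing Implicit Defensive.

(** The graph is a voltage lift: its vertices are two copies of a group of
    order 504, namely (Q_8 x Z_7) : Z_9, and its edges are invariant under left
    translation, so that every vertex can be moved to one of the two base
    vertices over the identity. A cycle of length at most 8 through a vertex [x]
    would give two walks of length at most 4 that leave [x] through different
    neighbours and meet; a finite computation at the two base vertices excludes
    this, and exhibits a cycle of length 9. *)

(** * Girth from balls *)

Section Girth.

Variables (T : eqType) (nb : T -> seq T).

(** [p] is the vertex just left, to which the next step must not return. Repetitions are kept, so
    that [uniq] detects two walks with the same end. *)
Fixpoint cone n (p x : T) : seq T :=
  x :: if n is m.+1 then flatten [seq cone m x y | y <- nb x & y != p] else [::].

(* Endpoints, with multiplicity, of the non-backtracking walks of length 1 to n + 1. *)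
Definition punctured_ball n x := flatten [seq cone n x y | y <- nb x].

Lemma mem_cone n p x q : path (fun u v => v \in nb u) x q ->
  uniq (p :: x :: q) -> size q <= n -> last x q \in cone n p x.
Proof.
elim: n p x q => [|n IHn] p x [|y q]; rewrite /= ?mem_head //.
case/andP=> xy yq /andP[pxyq /andP[xq uq]] szq.
rewrite inE; apply/orP; right; apply/flattenP; exists (cone n x y).
  apply: map_f; rewrite mem_filter xy andbT.
  by apply: contraNneq pxyq => ->; rewrite !inE eqxx orbT.
by apply: IHn => //=; rewrite xq.
Qed.

Lemma uniq_flatten_map_inj (S : eqType) (f : S -> seq T) (s : seq S) u v z :
  uniq (flatten (map f s)) -> u \in s -> v \in s -> z \in f u -> z \in f v -> u = v.
Proof.
elim: s => //= w s IHs; rewrite cat_uniq => /and3P[_ /hasPn dis us].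
rewrite !inE => /predU1P[->|su] /predU1P[->|sv] // zu zv; last exact: IHs.
  by have /dis/negP[] : z \in flatten (map f s) by apply/flatten_mapP; exists v.
by have /dis/negP[] : z \in flatten (map f s) by apply/flatten_mapP; exists u.
Qed.

Lemma mem_cone_rcons n x p z : path (fun u v => v \in nb u) x (rcons p z) ->
  uniq (x :: rcons p z) -> size p <= n ->
  head z p \in nb x /\ z \in cone n x (head z p).
Proof.
case: p => [|y p] /=; first by rewrite andbT; case: n => [|n] ->; rewrite mem_head.
case/andP=> -> yp uxp szp; split=> //.
by rewrite -[in X in X \in _](last_rcons y p z) mem_cone // size_rcons.
Qed.

Hypothesis nb_sym : forall x y, (y \in nb x) = (x \in nb y).

Lemma uniq_ball_cycle n c : (forall x, uniq (punctured_ball n x)) ->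
  ucycle (fun u v => v \in nb u) c -> 2 < size c -> n.*2.+3 <= size c.
Proof.
move=> ball /andP[cyc uc] szc; rewrite leqNgt; apply/negP => ltc.
case: c => [//|x p] in cyc uc szc ltc.
(* The vertex at index [k] of [p] lies opposite to [x]: in a cycle of size at most 2n + 2, at most n
   vertices of [p] lie on either side of it, and at least one after it. *)
pose k := (size p).-1./2.
have lt_k : k < size p by move: szc; rewrite /= /k; lia.
have [p1 [z [p2 [def_p sz1 sz2 p2_nil]]]] : exists p1 z p2,
    [/\ p = p1 ++ z :: p2, size p1 <= n, size p2 <= n & 0 < size p2].
  exists (take k p), (nth x p k), (drop k.+1 p).
  rewrite -drop_nth // cat_take_drop size_takel ?(ltnW lt_k) // size_drop.
  by split=> //; move: szc ltc; rewrite /= /k; lia.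
have [] := @mem_cone_rcons n x p1 z _ _ sz1.
- by move: cyc; rewrite /= def_p -cat_rcons rcons_cat cat_path => /andP[].
- by move: uc; rewrite def_p -cat_rcons -cat_cons cat_uniq => /andP[].
have rcyc : path (fun u v => v \in nb u) x (rcons (rev p) x).
  have := rev_path (fun u v => v \in nb u) x (rcons p x).
  rewrite last_rcons belast_rcons rev_cons => ->.
  by rewrite (@eq_path _ _ (fun u v => v \in nb u)) // => u v; rewrite nb_sym.
have [] := @mem_cone_rcons n x (rev p2) z; rewrite ?size_rev //.
- move: rcyc; rewrite def_p rev_cat rev_cons rcons_path => /andP[+ _].
  by rewrite cat_path => /andP[].
- move: uc; rewrite /= -rev_cons rev_uniq mem_rev def_p mem_cat negb_or cat_uniq.
  by move=> /andP[/andP[_ ->]] /and3P[].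
move=> hx2 z2 hx1 z1.
have eq_h := uniq_flatten_map_inj (ball x) hx1 hx2 z1 z2.
(* The arcs leave [x] through [head z p1], which is [z] if [p1] is empty, and through the last
   vertex of [p2]. Their equality would repeat a vertex of the cycle. *)
move: uc; rewrite def_p cons_uniq -cat_rcons cat_uniq.
case/andP=> _ /and3P[_ /hasPn/(_ (head z p1)) + _].
case/lastP: p2 p2_nil eq_h {def_p sz2 hx2 z2} => // p2 w _.
rewrite rev_rcons /= => <-; rewrite mem_rcons mem_head => /(_ isT)/negP[].
by case: (p1) => [|y q] /=; rewrite mem_head.
Qed.

End Girth.

(** * Equivariance of cones and balls *)

Section Translation.

Variables (T : eqType) (nb : T -> seq T) (f : T -> T).
Hypothesis nb_f : forall x, nb (f x) = map f (nb x).
Hypothesis f_inj : injective f.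

Lemma cone_map n p x : cone nb n (f p) (f x) = map f (cone nb n p x).
Proof.
elim: n p x => //= n IHn p x; congr cons.
rewrite map_flatten nb_f filter_map -!map_comp; congr flatten.
rewrite (@eq_filter _ (preim f _) (fun y => y != p)); last first.
  by move=> y /=; rewrite (inj_eq f_inj).
by apply: eq_map => y /=; rewrite IHn.
Qed.

Lemma punctured_ball_map n x :
  punctured_ball nb n (f x) = map f (punctured_ball nb n x).
Proof.
rewrite /punctured_ball nb_f map_flatten -!map_comp; congr flatten.
by apply: eq_map => y /=; rewrite cone_map.
Qed.

End Translation.

(** * The voltage group *)

(* F_4 with basis 1, w, and w^2 = 1 + w. *)
Definition F4 := (bool * bool)%type.

Definition addF4 (u v : F4) : F4 := (u.1 (+) v.1, u.2 (+) v.2).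

Definition mulw (u : F4) : F4 := (u.2, u.1 (+) u.2).

(* The trace of w u v^2, which is bilinear, invariant under [mulw], and equal to
   1 whenever u = v <> 0; it is the cocycle that defines Q_8 over F_4. *)
Definition cocycle (u v : F4) : bool :=
  (u.1 && v.1) (+) (u.2 && (v.1 (+) v.2)).

Definition voltage := (bool * F4 * 'Z_7 * 'Z_9)%type.

(** Z_9 acts through its quotient of order 3: by [mulw] on Q_8 and by doubling on Z_7. *)
Definition mulv (g h : voltage) : voltage :=
  let: (z, u, a, i) := g in
  let: (z', v, b, j) := h in
  let v' := iter i mulw v in
  (z (+) z' (+) cocycle u v', addF4 u v', (a + 2 ^+ i * b)%R, (i + j)%R).

(** The 2-cocycle identity, behind the associativity of Q_8. *)
Lemma cocycleP u v w :
  cocycle u v (+) cocycle (addF4 u v) w = cocycle v w (+) cocycle u (addF4 v w).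
Proof. by case: u v w => [[] []] [[] []] [[] []]. Qed.

Lemma addF4A : associative addF4.
Proof. by move=> u v w; rewrite /addF4 /= !addbA. Qed.

Lemma addF4I : right_injective addF4.
Proof. by move=> u [v1 v2] [w1 w2] [/addbI-> /addbI->]. Qed.

Lemma cocycle_mulw i u v : cocycle (iter i mulw u) (iter i mulw v) = cocycle u v.
Proof.
elim: i => //= i <-.
by case: (iter i mulw u) (iter i mulw v) => [[] []] [[] []].
Qed.

Lemma iter_mulwD i u v :
  iter i mulw (addF4 u v) = addF4 (iter i mulw u) (iter i mulw v).
Proof.
elim: i => //= i ->.
by case: (iter i mulw u) (iter i mulw v) => [[] []] [[] []].
Qed.

Lemma iter_mulw_inj i : injective (iter i mulw).
Proof.
elim: i => //= i IHi u v /= uv; apply: IHi; move: uv.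
by case: (iter i mulw u) (iter i mulw v) => [[] []] [[] []].
Qed.

Lemma iter_mulw_Zp (i j : 'Z_9) u :
  iter (i + j)%R mulw u = iter i mulw (iter j mulw u).
Proof.
have w3 k v : iter (9 * k) mulw v = v.
  by rewrite mulnC; elim: k => //= k ->; case: v => [[] []].
by rewrite -iterD [in RHS](divn_eq (i + j) 9) mulnC addnC iterD w3.
Qed.

Lemma exp2_Zp (i j : 'Z_9) : (2 ^+ (i + j)%R = 2 ^+ i * 2 ^+ j :> 'Z_7)%R.
(* Exponents may be reduced modulo 9 because 2^9 = 1 modulo 7. *)
Proof. by rewrite -GRing.exprD /= GRing.expr_mod //; apply/val_inj. Qed.

Lemma mulvA : associative mulv.
Proof.
move=> [[[z u] a] i] [[[z' v] b] j] [[[z'' w] c] k] /=.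
rewrite iter_mulw_Zp iter_mulwD addF4A GRing.addrA exp2_Zp.
rewrite GRing.mulrDr GRing.mulrA GRing.addrA; congr (_, _, _, _).
rewrite -(cocycle_mulw i v).
have := cocycleP u (iter i mulw v) (iter i mulw (iter j mulw w)).
by move: (cocycle _ _) (cocycle _ _) (cocycle _ _) (cocycle _ _) z z' z''; do 7!case.
Qed.

Lemma mulvI : right_injective mulv.
Proof.
move=> [[[z u] a] i] [[[z' v] b] j] [[[z'' w] c] k] eq_m.
have /addF4I/iter_mulw_inj eq_v := congr1 (fun g => g.1.1.2) eq_m.
have /GRing.addrI := congr1 (fun g => g.1.2) eq_m.
have /GRing.addrI -> := congr1 (fun g => g.2) eq_m.
have /GRing.mulrI inj2 : (2 ^+ i : 'Z_7)%R \is a GRing.unit by rewrite GRing.unitrX.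
have := congr1 (fun g => g.1.1.1) eq_m; rewrite /= eq_v -!addbA.
by move=> /addbI/addIb-> /inj2 ->.
Qed.

(** * The graph *)

Definition volt z x y a i : voltage := (z, (x, y), inZp a, inZp i).

(* The labels were found by a computer search. Each one occurs once from each end
   of its edge, the second time inverted. *)
Definition darts (e : bool) : seq (bool * voltage) :=
  if e then
    [:: (false, volt false false false 0 0); (false, volt true true false 0 8);
        (false, volt true true true 3 5);
        (true, volt true false false 1 2); (true, volt true false false 5 7)]
  else
    [:: (true, volt false false false 0 0); (true, volt false false true 0 1);
        (true, volt false true false 1 4);
        (false, volt false false true 0 2); (false, volt true true true 0 7)].

(** Labels multiply on the right, so that left translations commute with [nb]. *)
Definition nb (x : bool * voltage) : seq (bool * voltage) :=
  [seq (d.1, mulv x.2 d.2) | d <- darts x.1].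

Definition base (e : bool) : bool * voltage := (e, (false, (false, false), 0%R, 0%R)).

Definition shift (g : voltage) (x : bool * voltage) := (x.1, mulv g x.2).

Lemma nb_shift g x : nb (shift g x) = map (shift g) (nb x).
Proof. by rewrite /nb -map_comp; apply: eq_map => d; rewrite /shift /comp mulvA. Qed.

Lemma shift_inj g : injective (shift g).
Proof. by move=> [e h] [e' h'] [-> /mulvI->]. Qed.

Lemma shift_base x : x = shift x.2 (base x.1).
Proof.
case: x => e [[[z u] a] i]; rewrite /shift /= iter_fix // GRing.mulr0 !GRing.addr0.
by case: u => u1 u2; rewrite /cocycle /addF4 /= !andbF !addbF.
Qed.

(** The radius 3 yields the bound 2 * 3 + 3 = 9 in [uniq_ball_cycle]. Each base vertex has 5 * (1 +
    4 + 16 + 64) = 425 endpoints to compare. *)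
Lemma uniq_ball_nb x : uniq (punctured_ball nb 3 x).
Proof.
rewrite (shift_base x) (punctured_ball_map (nb_shift _) (@shift_inj _)).
rewrite (map_inj_uniq (@shift_inj _)).
by case: x.1; vm_compute.
Qed.

Lemma uniq_nb x : uniq (nb x).
Proof.
rewrite (shift_base x) nb_shift (map_inj_uniq (@shift_inj _)).
by case: x.1; vm_compute.
Qed.

Lemma size_nb x : size (nb x) = 5.
Proof. by case: x => [[] g]; rewrite size_map. Qed.

Lemma nb_irr x : x \notin nb x.
Proof.
rewrite (shift_base x) nb_shift (mem_map (@shift_inj _)).
by case: x.1; vm_compute.
Qed.

(** After a translation only the ten darts at the base vertices remain to be checked. *)
Lemma nb_symW x y : y \in nb x -> x \in nb y.
Proof.
rewrite (shift_base x) nb_shift => /mapP[y0 y0x ->].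
rewrite nb_shift (mem_map (@shift_inj _)).
have /allP : all (fun y => base x.1 \in nb y) (nb (base x.1)).
  by case: x.1; vm_compute.
exact.
Qed.

Lemma nb_sym x y : (y \in nb x) = (x \in nb y).
Proof. by apply/idP/idP; apply: nb_symW. Qed.

Lemma nb_rel_sym : symmetric (fun x y => y \in nb x).
Proof. by move=> x y; rewrite nb_sym. Qed.

Lemma nb_rel_irr : irreflexive (fun x y => y \in nb x).
Proof. by move=> x; apply/negbTE/nb_irr. Qed.

Definition lift := SGraph nb_rel_sym nb_rel_irr.

Lemma card_lift : #|lift| = 1008.
Proof. by rewrite !card_prod !card_bool !card_ord. Qed.

Lemma regular_lift : regular lift 5.
Proof.
move=> x; apply: etrans (size_nb x); rewrite cardsE.
by apply: etrans (card_uniqP (uniq_nb x)); apply: eq_card.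
Qed.

Definition nonagon : seq (bool * voltage) :=
  [:: (false, volt false false false 0 0); (true, volt false false false 0 0);
    (false, volt true true false 0 8); (true, volt true true false 0 8);
    (false, volt true false true 0 7); (true, volt true false true 0 7);
    (true, volt false false true 3 5); (true, volt true false true 2 3);
    (true, volt false false true 0 1)].

Lemma girth_lift : girth_is lift 9.
Proof.
split=> [|c [cyc szc]]; first by exists nonagon; split; first by split; vm_compute.
exact: (uniq_ball_cycle nb_sym uniq_ball_nb cyc szc).
Qed.

(** Existence of a graph of given order is a [Prop], not a boolean test, so the descent to the least
    order uses excluded middle. *)
Lemma ex_minimum (P : nat -> Prop) n :
  P n -> exists m, [/\ P m, m <= n & forall k, P k -> m <= k].
Proof.
elim/ltn_ind: n => n IHn Pn.
have [[k [Pk lt_kn]]|minn] := classic (exists k, P k /\ k < n).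
  have [m [Pm le_mk minm]] := IHn k lt_kn Pk.
  by exists m; split=> //; apply: leq_trans le_mk (ltnW lt_kn).
exists n; split=> // k Pk; rewrite leqNgt; apply/negP => lt_kn.
by apply: minn; exists k.
Qed.

Theorem mainTheorem6 :
  (exists n : nat, is_min_order 5 9 n /\ n <= 1116) /\
  (exists G : sgraph, kg_graph 5 9 G /\ #|G| <= 1116).
Proof.
have kg_lift : kg_graph 5 9 lift := conj regular_lift girth_lift.
split; last by exists lift; rewrite card_lift.
(* The descent starts at 1008 = 2 * 504, the order of [lift], already below 1116. *)
have [|n [exn le_n minn]] :=
    @ex_minimum (fun n => exists G, kg_graph 5 9 G /\ #|G| = n) 1008.
  by exists lift; rewrite card_lift.
exists n; split; last exact: leq_trans le_n _.
by split=> // G kgG; apply: minn; exists G.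
Qed.
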